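(* Let $\mathcal{C}\in\mathbb{C}^{N\times N}$ be the Cauchy matrix with entries $\mathcal{C}_{hk}=\frac{1}{\mu_h-\lambda_k}$, and let $\widetilde{\mathcal{C}}$ be an $(\alpha,\beta)$-HSS matrix that approximates $\mathcal{C}$ accurately. Let $\mathbf{y}\in\mathbb{C}^N$, $x\in\{f_i\}$ and $\widetilde{\mathbf{y}}=(\Lambda-xI)\mathbf{y}$. If the Loewner and shifted Loewner matrices $\mathbb{L},\mathbb{S}\in\mathbb{C}^{N\times N}$ satisfy the Sylvester equations $M\mathbb{L}-\mathbb{L}\Lambda=\mathbf{V}\mathbf{R}-\mathbf{L}\mathbf{W}$ and $M\mathbb{S}-\mathbb{S}\Lambda=M\mathbf{V}\mathbf{R}-\mathbf{L}\mathbf{W}\Lambda$, then $$(\mathbb{S}-x\mathbb{L})\mathbf{y}=\sum_{j=1}^q \widetilde{\mathbf{v}}_j\circ\bigl(\widetilde{\mathcal{C}}(\widetilde{\mathbf{r}}_j^{*}\circ\widetilde{\mathbf{y}})\bigr)-\sum_{j=1}^p\widetilde\ell_j\circ\bigl(\widetilde{\mathcal{C}}(\widetilde{\mathbf{w}}_j^{*}\circ\widetilde{\mathbf{y}})\bigr)+\mathbf{V}\mathbf{R}\mathbf{y}+\mathcal{E}\widetilde{\mathbf{y}},$$ where $$\|\mathcal{E}\|\le (p+q)\,\|\mathcal{C}-\widetilde{\mathcal{C}}\|\,\bigl(\max\{\|\mathbf{V}\|_\infty,\|\mathbf{R}\|_\infty,\|\mathbf{L}\|_\infty,\|\mathbf{W}\|_\infty\}\bigr)^2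 .$$ Moreover, the computational cost of performing $$\sum_{j=1}^q \widetilde{\mathbf{v}}_j\circ\bigl(\widetilde{\mathcal{C}}(\widetilde{\mathbf{r}}_j^{*}\circ\widetilde{\mathbf{y}})\bigr)-\sum_{j=1}^p\widetilde\ell_j\circ\bigl(\widetilde{\mathcal{C}}(\widetilde{\mathbf{w}}_j^{*}\circ\widetilde{\mathbf{y}})\bigr)+\mathbf{V}\mathbf{R}\mathbf{y}$$ amounts to $\mathcal{O}((p+q)(\alpha+\beta+1)N)$ floating point operations.
   Context: Setting (Loewner framework). Given are real frequencies $f_j$, $j=1,\dots,N$, with $\omega_j=2\pi f_j$, and measurements $\mathbf{H}_j\in\mathbb{C}^{p\times q}$ at the points $\mathrm{i}\omega_j$; the data are completed by complex conjugation, i.e. the measurement at $-\mathrm{i}\omega_j$ is $\overline{\mathbf{H}}_j$. The points $\pm\mathrm{i}\omega_j$ are partitioned into two disjoint sets: the right points $\lambda_1,\dots,\lambda_N$ and the left points $\mu_1,\dots,\mu_N$. Right tangential directions are column vectors $\mathbf{r}_k\in\mathbb{C}^q$, and the right vector data $\mathbf{w}_k\in\mathbb{C}^p$ equal the measurement at $\lambda_k$ times $\mathbf{r}_k$. Left tangential directions are row vectors $\ell_h\in\mathbb{C}^{1\times p}$, and the left vector data $\mathbf{v}_h\in\mathbb{C}^{1\times q}$ equal $\ell_h$ times the measurement at $\mu_h$. The Loewner and shifted Loewner matrices are defined entrywise by $$\mathbb{L}_{hk}=\frac{\mathbf{v}_h\mathbf{r}_k-\ell_h\mathbf{w}_k}{\mu_h-\lambda_k},\qquad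 \mathbb{S}_{hk}=\frac{\mu_h\mathbf{v}_h\mathbf{r}_k-\lambda_k\ell_h\mathbf{w}_k}{\mu_h-\lambda_k},\qquad h,k=1,\dots,N.$$ Data matrices: $\Lambda=\operatorname{diag}(\lambda_1,\dots,\lambda_N)$, $M=\operatorname{diag}(\mu_1,\dots,\mu_N)$; $\mathbf{R}=[\mathbf{r}_1,\dots,\mathbf{r}_N]\in\mathbb{C}^{q\times N}$, $\mathbf{W}=[\mathbf{w}_1,\dots,\mathbf{w}_N]\in\mathbb{C}^{p\times N}$; $\mathbf{L}\in\mathbb{C}^{N\times p}$ has rows $\ell_1,\dots,\ell_N$ and $\mathbf{V}\in\mathbb{C}^{N\times q}$ has rows $\mathbf{v}_1,\dots,\mathbf{v}_N$. The vectors $\widetilde{\mathbf{v}}_1,\dots,\widetilde{\mathbf{v}}_q\in\mathbb{C}^N$ and $\widetilde\ell_1,\dots,\widetilde\ell_p\in\mathbb{C}^N$ are the columns of $\mathbf{V}$ and $\mathbf{L}$; $\widetilde{\mathbf{r}}_1,\dots,\widetilde{\mathbf{r}}_q\in\mathbb{C}^{1\times N}$ and $\widetilde{\mathbf{w}}_1,\dots,\widetilde{\mathbf{w}}_p\in\mathbb{C}^{1\times N}$ are the rows of $\mathbf{R}$ and $\mathbf{W}$. Here $^*$ denotes the complex conjugate transpose, $\circ$ the Hadamard (entrywise) product, $I$ the identity matrix, $\|\cdot\|$ the spectral norm, and $\|\cdot\|_\infty$ the infinity norm. HSS matrices. Let $A$ be an $N\times N$ matrix, $\alpha$ the maximum rank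 of all its subdiagonal blocks (blocks of all sizes lying strictly below the block diagonal) and $\beta$ the maximum rank of all its superdiagonal blocks (blocks of all sizes lying strictly above the block diagonal). $A$ is $(\alpha,\beta)$-HSS (hierarchically semiseparable) if its diagonal blocks consist of $\mathcal{O}((\alpha+\beta)N)$ entries. A matrix-vector product with an $(\alpha,\beta)$-HSS matrix costs $\mathcal{O}((\alpha+\beta)N)$ floating point operations. ''Accurately'' is used without a quantitative condition.
   Formalization: The conjugate transposes of the rows of R and W in the sums are replaced by plain transposes, since with complex conjugation the identity with the stated error bound fails for complex data. *)

(* Defs.v *)
(* MathComp world: complex numbers are R[i] over an R : realType. *)
From HB Require Import structures.
From mathcomp Require Import all_boot all_order all_algebra.
From mathcomp Require Import all_classical all_reals all_analysis.
From mathcomp Require Import complex.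

Set Implicit Arguments.
Unset Strict Implicit.
Unset Printing Implicit Defensive.

Import Order.TTheory GRing.Theory Num.Theory.

Local Open Scope ring_scope.

Section LoewnerData.
Variables (R : realType) (N p q : nat).
Local Notation C := R[i].

(* The label (j, false) stands for i * omega_j and (j, true) for its conjugate
   -i * omega_j; the measurement attached to a label is H_j, resp. conj(H_j). *)
Definition sample_point (f : 'I_N -> R) (a : 'I_N * bool) : C :=
  let z := (0 +i* (2 * pi * f a.1))%C in if a.2 then - z else z.

Definition sample_value (H : 'I_N -> 'M[C]_(p, q)) (a : 'I_N * bool) :
    'M[C]_(p, q) :=
  if a.2 then map_mx conjc (H a.1) else H a.1.

(* The partition is carried by the labels, so that each right or left point
   comes with its own measurement; [points_disjoint] states in addition that
   the two sets of complex numbers are disjoint. *)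
Record loewner_data := LoewnerData {
  freq : 'I_N -> R;
  meas : 'I_N -> 'M[C]_(p, q);
  right_label : 'I_N -> 'I_N * bool;
  left_label : 'I_N -> 'I_N * bool;
  labels_partition :
    perm_eq (codom right_label ++ codom left_label)
            (enum {: 'I_N * bool});
  points_disjoint : forall h k : 'I_N,
    sample_point freq (left_label h) != sample_point freq (right_label k);
  right_dir : 'I_N -> 'cV[C]_q;
  left_dir : 'I_N -> 'rV[C]_p
}.

Variable D : loewner_data.

Definition lambda (k : 'I_N) : C := sample_point (freq D) (right_label D k).
Definition mu (h : 'I_N) : C := sample_point (freq D) (left_label D h).

Definition right_data (k : 'I_N) : 'cV[C]_p :=
  sample_value (meas D) (right_label D k) *m right_dir D k.
Definition left_data (h : 'I_N) : 'rV[C]_q :=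
  left_dir D h *m sample_value (meas D) (left_label D h).

Definition Lambda_mx : 'M[C]_N := diag_mx (\row_k lambda k).
Definition M_mx : 'M[C]_N := diag_mx (\row_h mu h).
Definition R_mx : 'M[C]_(q, N) := \matrix_(i, k) right_dir D k i 0.
Definition W_mx : 'M[C]_(p, N) := \matrix_(i, k) right_data k i 0.
Definition L_mx : 'M[C]_(N, p) := \matrix_(h < N) left_dir D h.
Definition V_mx : 'M[C]_(N, q) := \matrix_(h < N) left_data h.

Definition loewner_mx : 'M[C]_N := \matrix_(h, k)
  (((left_data h *m right_dir D k) 0 0 - (left_dir D h *m right_data k) 0 0)
   / (mu h - lambda k)).

Definition shifted_loewner_mx : 'M[C]_N := \matrix_(h, k)
  ((mu h * (left_data h *m right_dir D k) 0 0
    - lambda k * (left_dir D h *m right_data k) 0 0)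
   / (mu h - lambda k)).

Definition cauchy_mx : 'M[C]_N := \matrix_(h, k) (mu h - lambda k)^-1.

End LoewnerData.

Section Norms.
Variable R : realType.
Local Notation C := R[i].

Definition cmod (z : C) : R := complex.Re `|z|.

Definition eucl_norm n (x : 'cV[C]_n) : R :=
  Num.sqrt (\sum_i cmod (x i 0) ^+ 2).

Definition spectral_norm m n (A : 'M[C]_(m, n)) : R :=
  sup [set eucl_norm (A *m x) | x in [set x | eucl_norm x <= 1]]%classic.

(* The operator norm induced by the vector infinity norm, i.e. the largest
   absolute row sum. *)
Definition infinity_norm m n (A : 'M[C]_(m, n)) : R :=
  \big[Num.max/0]_(i < m) \sum_(j < n) cmod (A i j).

End Norms.

Section HSS.
Variables (F : fieldType) (N m : nat).

(* A block partition of the index set into consecutive intervals is given by a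
   nondecreasing map sending each index to the number of its block; [blk_range]
   is the union of the consecutive blocks a, ..., b. *)
Variable blk : 'I_N -> 'I_m.

Definition blk_range (a b : 'I_m) : {set 'I_N} :=
  [set i : 'I_N | (a <= blk i <= b)%N].

Definition submx_on (A : 'M[F]_N) (I J : {set 'I_N}) : 'M[F]_(#|I|, #|J|) :=
  mxsub (@enum_val _ (mem I)) (@enum_val _ (mem J)) A.

Definition sub_rank (A : 'M[F]_N) : nat :=
  \max_(a < m) \max_(b < m) \max_(c < m) \max_(d < m | (d < a)%N)
    \rank (submx_on A (blk_range a b) (blk_range c d)).

Definition super_rank (A : 'M[F]_N) : nat :=
  \max_(a < m) \max_(b < m) \max_(c < m) \max_(d < m | (b < c)%N)
    \rank (submx_on A (blk_range a b) (blk_range c d)).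

Definition diag_blocks_size : nat :=
  #|[set ij : 'I_N * 'I_N | blk ij.1 == blk ij.2]|.

End HSS.

(* [kappa] is the constant hidden in the O((alpha + beta) N) bound on the
   number of entries of the diagonal blocks. *)
Definition is_HSS (F : fieldType) (N kappa alpha beta : nat) (A : 'M[F]_N) :
    Prop :=
  exists (m : nat) (blk : 'I_N -> 'I_m),
    [/\ {homo blk : i j / (i <= j)%N},
        alpha = sub_rank blk A,
        beta = super_rank blk A
      & (diag_blocks_size blk <= kappa * ((alpha + beta) * N))%N].

Definition hadamard (F : pzRingType) m n (A B : 'M[F]_(m, n)) : 'M[F]_(m, n) :=
  map2_mx *%R A B.

(* The rows of R and W are turned into columns by plain transposition. With a
   conjugate transposition the formula for (S - x L) y fails for complex data:
   take N = p = q = 1, r = l = 1, H = i, Ct = C (which forces E = 0). *)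
Definition fast_product (F : pzRingType) N p q (Ct : 'M[F]_N)
    (V : 'M[F]_(N, q)) (Rm : 'M[F]_(q, N)) (L : 'M[F]_(N, p))
    (W : 'M[F]_(p, N)) (yt y : 'cV[F]_N) : 'cV[F]_N :=
  \sum_(j < q) hadamard (col j V) (Ct *m hadamard (row j Rm)^T yt)
  - \sum_(j < p) hadamard (col j L) (Ct *m hadamard (row j W)^T yt)
  + V *m Rm *m y.

(* Cost model: straight-line programs over F. Every instruction is one
   arithmetic operation and appends its result to the list of registers;
   operands are constants, inputs or earlier registers. The cost is the number
   of instructions. Division is left out, so cost bounds in this model also
   hold when divisions are allowed. *)
Inductive operand (F X : Type) :=
  | Const of F
  | Input of X
  | Reg of nat.

Inductive flop := FAdd | FSub | FMul.

Record instr (F X : Type) := Instr {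
  instr_op : flop;
  instr_left : operand F X;
  instr_right : operand F X
}.

Section StraightLine.
Variables (F : pzRingType) (X : Type).

Definition operand_val (env : X -> F) (regs : seq F) (o : operand F X) : F :=
  match o with
  | Const c => c
  | Input x => env x
  | Reg i => nth 0 regs i
  end.

Definition flop_val (o : flop) (a b : F) : F :=
  match o with
  | FAdd => a + b
  | FSub => a - b
  | FMul => a * b
  end.

Fixpoint run (env : X -> F) (prog : seq (instr F X)) (regs : seq F) : seq F :=
  if prog is i :: prog' then
    run env prog'
      (rcons regs (flop_val (instr_op i)
                     (operand_val env regs (instr_left i))
                     (operand_val env regs (instr_right i))))
  else regs.

Definition computable_within n (f : (X -> F) -> 'cV[F]_n) (t : nat) : Prop :=
  exists (prog : seq (instr F X)) (out : 'I_n -> operand F X),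
    (size prog <= t)%N /\
    forall env : X -> F,
      f env = \col_i operand_val env (run env prog [::]) (out i).

End StraightLine.

Inductive slot (N p q : nat) :=
  | SlotV of 'I_N & 'I_q
  | SlotR of 'I_q & 'I_N
  | SlotL of 'I_N & 'I_p
  | SlotW of 'I_p & 'I_N
  | SlotYt of 'I_N
  | SlotY of 'I_N.
Arguments SlotV {N p q}.
Arguments SlotR {N p q}.
Arguments SlotL {N p q}.
Arguments SlotW {N p q}.
Arguments SlotYt {N p q}.
Arguments SlotY {N p q}.

(* [Ct] is a parameter while all entries of V, R, L, W, yt and y are inputs:
   a program evaluating this map may store constants depending on [Ct] (its
   HSS representation) but must work for all values of the other data. *)
Definition fast_product_map (F : pzRingType) N p q (Ct : 'M[F]_N)
    (env : slot N p q -> F) : 'cV[F]_N :=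
  fast_product Ct
    (\matrix_(h, j) env (SlotV h j)) (\matrix_(j, k) env (SlotR j k))
    (\matrix_(h, j) env (SlotL h j)) (\matrix_(j, k) env (SlotW j k))
    (\col_k env (SlotYt k)) (\col_k env (SlotY k)).

(* Main.v *)
(* Since S - x L = V R + (C o (V R - L W)) (Lambda - x I), where o is the
   Hadamard product, and C o (v r) = diag(v) C diag(r) for a column v and a row
   r, replacing C by Ct gives the error matrix
   E = sum_j diag(v_j) (C - Ct) diag(r_j) - sum_j diag(l_j) (C - Ct) diag(w_j).

   For the cost, the product of Ct with a vector u is evaluated by sweeping over
   the block boundaries. At a boundary, the partial products phi_i of the rows i
   below it with the part of u before it span a space of dimension at most
   alpha, and it suffices to keep in registers those phi_i whose rows form a
   basis. Moving one row or one column across the boundary brings at most one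
   new row into the basis, so it costs O(alpha) operations, without the factor
   alpha^2 of a general change of basis. The superdiagonal part is treated by
   sweeping backwards. *)
Require Import Defs.
From HB Require Import structures.
From mathcomp Require Import all_boot all_order all_algebra.
From mathcomp Require Import all_classical all_reals all_analysis.
From mathcomp Require Import complex.
From mathcomp Require Import zify ring lra.
From mathcomp Require Import fintype finset.

Set Implicit Arguments.
Unset Strict Implicit.
Unset Printing Implicit Defensive.

Import Order.TTheory GRing.Theory Num.Theory.

Local Open Scope ring_scope.

(** * Straight-line programs built by appending instructions *)

Section Programs.
Variables (F : pzRingType) (X : Type).
Implicit Types (p e : seq (instr F X)) (g : (X -> F) -> F).

Lemma run_cat env p e regs : run env (p ++ e) regs = run env e (run env p regs).
Proof. by elim: p regs => //= i p IHp regs; rewrite IHp. Qed.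

Lemma size_run env p regs : size (run env p regs) = (size regs + size p)%N.
Proof.
by elim: p regs => [|i p IHp] regs /=; rewrite ?addn0 // IHp size_rcons addSnnS.
Qed.

Lemma nth_run env p regs k : (k < size regs)%N ->
  nth 0 (run env p regs) k = nth 0 regs k.
Proof.
elim: p regs => //= i p IHp regs lt_k.
by rewrite IHp ?size_rcons ?ltnS 1?ltnW // nth_rcons lt_k.
Qed.

(* Quantifying over all continuations [e] excludes operands that refer to a
   register not yet written, which reads as 0 only until it is filled. *)
Definition avail p g :=
  exists o, forall e env, operand_val env (run env (p ++ e) [::]) o = g env.

(** Appending leaves every register already written at its index, so available values stay
    available; the bounds [n] add up along a chain of extensions and become the cost. *)
Definition extends n p p' := exists2 e, p' = p ++ e & (size e <= n)%N.

Lemma extends_refl n p : extends n p p.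
Proof. by exists [::]; rewrite ?cats0. Qed.

Lemma extends_trans m n p p1 p2 :
  extends m p p1 -> extends n p1 p2 -> extends (m + n) p p2.
Proof.
move=> [e1 -> le1] [e2 -> le2]; exists (e1 ++ e2); first by rewrite catA.
by rewrite size_cat leq_add.
Qed.

Lemma extends_leq m n p p' : (m <= n)%N -> extends m p p' -> extends n p p'.
Proof. by move=> le_mn [e -> le_e]; exists e => //; apply: leq_trans le_mn. Qed.

Lemma avail_extends n p p' g : extends n p p' -> avail p g -> avail p' g.
Proof.
by move=> [e -> _] [a aP]; exists a => e' env; rewrite -catA aP.
Qed.

Lemma eq_avail p g g' : g =1 g' -> avail p g -> avail p g'.
Proof. by move=> eq_g [a aP]; exists a => e env; rewrite aP eq_g. Qed.

Lemma avail_const p c : avail p (fun=> c).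
Proof. by exists (Const X c). Qed.

Lemma avail_input p x : avail p (fun env => env x).
Proof. by exists (Input F x). Qed.

Lemma avail_flop f p g1 g2 : avail p g1 -> avail p g2 ->
  exists2 p', extends 1 p p' & avail p' (fun env => flop_val f (g1 env) (g2 env)).
Proof.
move=> [a aP] [b bP]; exists (p ++ [:: Instr f a b]).
  by exists [:: Instr f a b].
(* Each instruction fills exactly one register, so the new result sits at index [size p]. *)
exists (Reg F X (size p)) => e env.
rewrite /= -catA run_cat /= nth_run; last by rewrite size_rcons size_run.
rewrite nth_rcons size_run /= add0n ltnn eqxx.
by have := aP [::] env; have := bP [::] env; rewrite cats0 => -> ->.
Qed.

(** The hypothesis covers all extensions [p1] of [p] because the values are computed one after
    another, each following the code for the others. *)
Lemma avail_map (A : eqType) c (s : seq A) (g : A -> (X -> F) -> F) p :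
  (forall x n p1, x \in s -> extends n p p1 ->
     exists2 p', extends c p1 p' & avail p' (g x)) ->
  exists2 p', extends (c * size s) p p' & forall x, x \in s -> avail p' (g x).
Proof.
elim: s => [|x s IHs] gP; first by exists p => //; apply: extends_refl.
have [|p1 pp1 p1P] := IHs.
  by move=> y n p1 ys; apply: gP; rewrite inE ys orbT.
have [|p2 p12 p2P] := gP x _ p1 _ pp1; first by rewrite mem_head.
exists p2; first by rewrite /= mulnS addnC; exact: extends_trans pp1 p12.
move=> y; rewrite inE => /predU1P[->//|/p1P]; exact: avail_extends p12.
Qed.

Lemma avail_map_flop (A : finType) f (g1 g2 : A -> (X -> F) -> F) p :
  (forall x, avail p (g1 x)) -> (forall x, avail p (g2 x)) ->
  exists2 p', extends #|A| p p' &
    forall x, avail p' (fun env => flop_val f (g1 x env) (g2 x env)).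
Proof.
move=> g1P g2P.
have [x n p1 _ pp1|p' pp' p'P] := @avail_map A 1 (enum A)
  (fun x env => flop_val f (g1 x env) (g2 x env)) p.
  by apply: avail_flop; apply: avail_extends pp1 _.
exists p' => [|x]; last by apply: p'P; rewrite mem_enum.
by rewrite -[#|A|]mul1n cardE.
Qed.

(** One multiplication and one addition per entry; the accumulator starts at the constant 0, which
    costs nothing. *)
Lemma avail_dot (A : eqType) (s : seq A) (h g : A -> (X -> F) -> F) p :
  (forall x, x \in s -> avail p (h x)) -> (forall x, x \in s -> avail p (g x)) ->
  exists2 p', extends (2 * size s) p p' &
    avail p' (fun env => \sum_(x <- s) h x env * g x env).
Proof.
elim: s => [|x s IHs] hP gP.
  exists p; first exact: extends_refl.
  by apply: eq_avail (avail_const p 0) => env; rewrite big_nil.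
have [y ys|y ys|p1 pp1 p1P] := IHs.
- by apply: hP; rewrite inE ys orbT.
- by apply: gP; rewrite inE ys orbT.
have [|//|p2 p12 p2P] := avail_flop FMul
  (avail_extends pp1 (hP x _)) (avail_extends pp1 (gP x _)).
- by rewrite mem_head.
- by rewrite mem_head.
have [p3 p23 p3P] := avail_flop FAdd p2P (avail_extends p12 p1P).
exists p3.
  rewrite /= mulnS addnC.
  exact: extends_trans pp1 (extends_trans p12 p23).
by apply: eq_avail p3P => env; rewrite big_cons.
Qed.

Lemma computable_within_avail n (f : (X -> F) -> 'cV[F]_n) t p :
  extends t [::] p -> (forall i, avail p (fun env => f env i 0)) ->
  computable_within f t.
Proof.
move=> [e -> /= size_e] /fin_all_exists[out outP]; exists e, out; split=> // env.
by apply/colP => i; have := outP i [::] env; rewrite cats0 mxE.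
Qed.

End Programs.

(** * Ranks of masked matrices and row bases *)

Section MaskedMatrices.
Variables (F : fieldType) (N : nat) (A : 'M[F]_N).
Implicit Types (T J I : {set 'I_N}).

(** Zeroing entries instead of extracting a block keeps the size fixed, so row spaces for different
    [T] can be compared directly. *)
Definition mask T J : 'M[F]_N :=
  \matrix_(i, j) (A i j *+ ((i \in T) && (j \in J))).

(** The 0-1 matrices [emb] put the rows and columns of the extracted block back in place, and
    multiplication does not raise the rank. *)
Lemma rank_mask T J : (\rank (mask T J) <= \rank (submx_on A T J))%N.
Proof.
pose emb S : 'M[F]_(N, #|S : {set 'I_N}|) := \matrix_(i, k) (i == enum_val k)%:R.
have -> : mask T J = emb T *m submx_on A T J *m (emb J)^T.
  apply/matrixP => i j; rewrite !mxE.
  under eq_bigr => k _ do rewrite !mxE big_distrl /=.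
  under eq_bigr => k _ do under eq_bigr => l _ do rewrite !mxE.
  case: (boolP (i \in T)) => [iT|iNT]; last first.
    rewrite big1 // => k _; rewrite big1 // => l _.
    case: eqP => [il|]; last by rewrite !mul0r.
    by rewrite il enum_valP in iNT.
  case: (boolP (j \in J)) => [jJ|jNJ]; last first.
    rewrite big1 // => k _; rewrite big1 // => l _.
    case: (j =P _) => [il|]; last by rewrite !mulr0.
    by rewrite il enum_valP in jNJ.
  rewrite (bigD1 (enum_rank_in jJ j)) //= [X in _ + X]big1 ?addr0.
    rewrite (bigD1 (enum_rank_in iT i)) //= [X in _ + X]big1 ?addr0.
      by rewrite !enum_rankK_in // !eqxx mul1r mulr1.
    move=> k nk; case: (i =P _) => [ik|]; last by rewrite !mul0r.
    by have := enum_valK_in iT k; rewrite -ik => e; rewrite e eqxx in nk.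
  move=> k nk; rewrite big1 // => l _.
  case: (j =P _) => [jk|]; last by rewrite !mulr0.
  by have := enum_valK_in jJ k; rewrite -jk => e; rewrite e eqxx in nk.
exact: leq_trans (mxrankM_maxl _ _) (mxrankM_maxr _ _).
Qed.

Lemma rank_mask_cardl T J : (\rank (mask T J) <= #|T|)%N.
Proof. exact: leq_trans (rank_mask T J) (rank_leq_row _). Qed.

Lemma rank_mask_cardr T J : (\rank (mask T J) <= #|J|)%N.
Proof. exact: leq_trans (rank_mask T J) (rank_leq_col _). Qed.

Lemma mask_subl T T' J : T \subset T' -> (mask T J <= mask T' J)%MS.
Proof.
move=> /subsetP sTT'; apply/row_subP => i.
case: (boolP (i \in T)) => iT.
  suff -> : row i (mask T J) = row i (mask T' J) by apply: row_sub.
  by apply/rowP => j; rewrite !mxE iT sTT'.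
suff -> : row i (mask T J) = 0 by apply: sub0mx.
by apply/rowP => j; rewrite !mxE (negPf iT) mulr0n.
Qed.

Lemma rank_mask_subr T J J' : J \subset J' ->
  (\rank (mask T J) <= \rank (mask T J'))%N.
Proof.
move=> /subsetP sJJ'.
suff -> : mask T J = mask T J' *m diag_mx (\row_j (j \in J)%:R).
  exact: mxrankM_maxl.
apply/matrixP => i j; rewrite mul_mx_diag !mxE.
case: (boolP (j \in J)) => [/sJJ' ->|_]; first by rewrite mulr1.
by rewrite andbF mulr0.
Qed.

Lemma rank_mask_setU1r T J j :
  (\rank (mask T (j |: J)) <= (\rank (mask T J)).+1)%N.
Proof.
have [jJ|jNJ] := boolP (j \in J).
  by rewrite (setUidPr _) ?sub1set // leqnSn.
have -> : mask T (j |: J) = mask T J + mask T [set j].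
  apply/matrixP => i k; rewrite !mxE !inE -mulrnDr.
  by case: (k =P j) => [->|]; rewrite ?(negPf jNJ) ?andbF ?addn0.
rewrite -addn1 (leq_trans (mxrank_add _ _)) // leq_add2l.
by rewrite -(cards1 j) rank_mask_cardr.
Qed.

(** The cardinality condition expresses linear independence of the rows in [I], restricted to the
    columns in [J]; the last condition says that they span. *)
Definition row_basis T J I :=
  [/\ I \subset T, #|I| = \rank (mask I J) & (mask T J <= mask I J)%MS].

Lemma row_basis_card T J I : row_basis T J I -> #|I| = \rank (mask T J).
Proof.
move=> [sIT -> sTI]; apply/eqP.
by rewrite eqn_leq !mxrankS // mask_subl.
Qed.

(** A maximal independent set containing [I] must span: a row outside the span could be added,
    raising the rank by one. *)
Lemma row_basis_extend T J I : I \subset T -> #|I| = \rank (mask I J) ->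
  exists2 I' : {set 'I_N}, I \subset I' & row_basis T J I'.
Proof.
move=> sIT freeI.
pose P (S : {set 'I_N}) := (S \subset T) && (#|S| == \rank (mask S J)).
have PI : P I by rewrite /P sIT freeI eqxx.
have [I' /maxsetP[/andP[sI'T /eqP freeI'] maxI'] sII'] := maxset_exists PI.
exists I' => //; split=> //; apply/row_subP => i.
have [iT|iNT] := boolP (i \in T); last first.
  suff -> : row i (mask T J) = 0 by apply: sub0mx.
  by apply/rowP => j; rewrite !mxE (negPf iNT) mulr0n.
apply: contraT => niI'.
have row_i (S : {set 'I_N}) : i \in S -> row i (mask T J) = row i (mask S J).
  by move=> iS; apply/rowP => j; rewrite !mxE iT iS.
have iNI' : i \notin I'.
  by apply: contra niI' => iI'; rewrite (row_i I') // row_sub.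
have lt_rank : (\rank (mask I' J) < \rank (mask (i |: I') J))%N.
  apply: rank_ltmx; rewrite ltmxE mask_subl ?subsetUr //=.
  apply: contra niI' => /(submx_trans _); apply.
  by rewrite (row_i (i |: I')) ?setU11 // row_sub.
have : P (i |: I').
  rewrite /P subUset sub1set iT sI'T eqn_leq rank_mask_cardl cardsU1 iNI' add1n.
  by rewrite freeI' lt_rank.
move=> /maxI'/(_ (subsetUr _ _)) eqI'.
by rewrite -eqI' setU11 in iNI'.
Qed.

End MaskedMatrices.

(** * The sweep over the block boundaries *)

Section TriangularProduct.
Variables (F : fieldType) (X : Type) (N : nat) (A : 'M[F]_N).
Variable u : 'I_N -> (X -> F) -> F.
Variable r : nat.
Implicit Types (p : seq (instr F X)) (T J I : {set 'I_N}).

Definition partial_dot J i (env : X -> F) := \sum_(j in J) A i j * u j env.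

Definition holds_basis p T J :=
  exists2 I, row_basis A T J I & forall i, i \in I -> avail p (partial_dot J i).

(** Row [i] is a combination of the basis rows, and the same combination of the stored products
    gives the product of row [i]. The coefficients depend on [A] only, so the program may contain
    them as constants. *)
Lemma avail_partial_dot p T J I i n : row_basis A T J I -> i \in T ->
  (#|I| <= n)%N ->
  (forall i, i \in I -> avail p (partial_dot J i)) ->
  exists2 p', extends (2 * n) p p' & avail p' (partial_dot J i).
Proof.
move=> [sIT freeI sTI] iT le_n IP.
have /submxP[d dP] := submx_trans (row_sub i _) sTI.
have [|x|p' pp' p'P] := @avail_dot F X _ (enum I)
  (fun k => fun=> d 0 k) (fun k => partial_dot J k) p.
- by move=> x _; apply: avail_const.
- by rewrite mem_enum; apply: IP.
exists p'; first by apply: extends_leq pp'; rewrite -cardE leq_mul2l.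
apply: eq_avail p'P => env; rewrite big_enum /=.
rewrite /partial_dot; under eq_bigr => k _ do rewrite mulr_sumr.
rewrite exchange_big /=; apply: eq_bigr => j jJ.
have := congr1 (fun v : 'rV_N => v 0 j) dP; rewrite !mxE iT jJ mulr1n => ->.
(* Coefficients of [d] outside [I] are arbitrary, but they meet zero rows of [mask A I J]. *)
rewrite mulr_suml [RHS](bigID (mem I)) /= [X in _ + X]big1 ?addr0.
  by apply: eq_bigr => k kI; rewrite mxE kI jJ mulr1n mulrA.
by move=> k kI; rewrite mxE (negPf kI) mulr0n mulr0 mul0r.
Qed.

(** Products for indices in [I] are kept, so only the at most [n] indices of [I' :\: I] are paid
    for, each as a combination of at most [r] stored values. *)
Lemma holds_basis_extend p T J I I' n : row_basis A T J I -> I' \subset T ->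
  (#|I| <= r)%N -> (#|I' :\: I| <= n)%N ->
  (forall i, i \in I -> avail p (partial_dot J i)) ->
  exists2 p', extends (2 * r * n) p p' &
    forall i, i \in I' -> avail p' (partial_dot J i).
Proof.
move=> basI sI'T le_r le_n IP.
have [i m p1|p' pp' p'P] :=
    @avail_map F X _ (2 * r) (enum (I' :\: I)) (partial_dot J) p.
  rewrite mem_enum inE => /andP[_ iI'] pp1.
  apply: (avail_partial_dot basI) => // [|k kI]; first exact: (subsetP sI'T).
  by apply: avail_extends pp1 _; apply: IP.
exists p'; first by apply: extends_leq pp'; rewrite -cardE leq_mul2l le_n orbT.
move=> i iI'; have [iI|iNI] := boolP (i \in I).
  by apply: avail_extends pp' _; apply: IP.
by apply: p'P; rewrite mem_enum inE iNI.
Qed.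

(* The basis with [t] removed needs at most one replacement. *)
Lemma remove_row p T J t : t \in T -> (\rank (mask A T J) <= r)%N ->
  holds_basis p T J ->
  exists2 p', extends (4 * r) p p' &
    holds_basis p' (T :\ t) J /\ avail p' (partial_dot J t).
Proof.
move=> tT le_r [I basI IP].
have cardI := row_basis_card basI.
have leI : (#|I| <= r)%N by rewrite cardI.
have [sIT freeI sTI] := basI.
have [p1 pp1 p1P] := avail_partial_dot basI tT leI IP.
(* Row [t] accounts for rank at most one, so the remaining rows of [I] stay independent. *)
have freeI1 : #|I :\ t| = \rank (mask A (I :\ t) J).
  apply/eqP; rewrite eqn_leq rank_mask_cardl andbT.
  rewrite -(leq_add2l (t \in I)) -cardsD1 freeI.
  have -> : mask A I J = mask A (I :\ t) J + mask A (I :&: [set t]) J.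
    apply/matrixP => i j; rewrite !mxE !inE -mulrnDr.
    by case: (i =P t) => _; case: (i \in I); case: (j \in J).
  rewrite addnC (leq_trans (mxrank_add _ _)) // leq_add2l.
  rewrite (leq_trans (rank_mask_cardl _ _ _)) //.
  rewrite setIC; case: (boolP (t \in I)) => tI.
    by rewrite (setIidPl _) ?sub1set // cards1.
  by rewrite leqn0 cards_eq0 setI_eq0 disjoints1.
have [I' sI1I' basI'] := row_basis_extend (setSD _ sIT) freeI1.
have [sI'T _ _] := basI'.
(* [I'] contains [I :\ t] and, by monotonicity of the rank, has no more elements than [I]. *)
have le1 : (#|I' :\: I| <= 1)%N.
  have := subset_leq_card (setDS I' (subsetDl I [set t])).
  move=> /leq_trans; apply; rewrite cardsD (setIidPr sI1I').
  rewrite (row_basis_card basI') leq_subLR.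
  rewrite (leq_trans (mxrankS (mask_subl _ _ (subsetDl T [set t])))) //.
  rewrite -cardI (cardsD1 t I) addnC leq_add2l.
  by case: (t \in I).
(* The replacement, like the product of row [t], is expressed in the old basis of [T]: [2 * r]
   instructions for each of the two. *)
have [||p2 p12 p2P] := holds_basis_extend (p := p1) basI _ leI le1.
- exact: subset_trans sI'T (subsetDl _ _).
- by move=> i iI; apply: avail_extends pp1 _; apply: IP.
exists p2; first by apply: extends_leq (extends_trans pp1 p12); lia.
split; last exact: avail_extends p12 _.
by exists I'.
Qed.

(** Independent rows stay independent over more columns and the rank grows by at most one, so at
    most one row joins the basis. Its product over the old columns is formed first, for [2 * r]
    instructions; then each of the at most [r] basis products receives its term for column [j], for
    two instructions. *)
Lemma add_column p T J j : j \notin J -> (forall j, avail p (u j)) ->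
  (\rank (mask A T (j |: J)) <= r)%N -> holds_basis p T J ->
  exists2 p', extends (4 * r) p p' & holds_basis p' T (j |: J).
Proof.
move=> jNJ uP le_r [I basI IP].
have cardI := row_basis_card basI.
have leI : (#|I| <= r)%N.
  by rewrite cardI (leq_trans _ le_r) // rank_mask_subr ?subsetUr.
have [sIT freeI sTI] := basI.
have freeI1 : #|I| = \rank (mask A I (j |: J)).
  apply/eqP; rewrite eqn_leq rank_mask_cardl andbT {1}freeI.
  by rewrite rank_mask_subr ?subsetUr.
have [I' sII' basI'] := row_basis_extend sIT freeI1.
have [sI'T _ _] := basI'; have cardI' := row_basis_card basI'.
have le1 : (#|I' :\: I| <= 1)%N.
  rewrite cardsD (setIidPr sII') cardI' leq_subLR cardI addn1.
  exact: rank_mask_setU1r.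
have [p1 pp1 p1P] := holds_basis_extend basI sI'T leI le1 IP.
have [i n p2|p2 p12 p2P] := @avail_map F X _ 2 (enum I') (partial_dot (j |: J)) p1.
  rewrite mem_enum => iI' p12.
  have [p3 p23 p3P] := avail_flop FMul (avail_const p2 (A i j))
    (avail_extends p12 (avail_extends pp1 (uP j))).
  have [p4 p34 p4P] := avail_flop FAdd p3P
    (avail_extends p23 (avail_extends p12 (p1P i iI'))).
  exists p4; first exact: extends_trans p23 p34.
  by apply: eq_avail p4P => env; rewrite /partial_dot big_setU1.
exists p2.
  apply: extends_leq (extends_trans pp1 p12); rewrite -cardE cardI'; lia.
by exists I' => // i iI'; apply: p2P; rewrite mem_enum.
Qed.

Lemma remove_rows p T J s : uniq s -> {subset s <= T} ->
  (\rank (mask A T J) <= r)%N -> holds_basis p T J ->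
  exists2 p', extends (4 * r * size s) p p' &
    holds_basis p' (T :\: [set t in s]) J /\
    forall t, t \in s -> avail p' (partial_dot J t).
Proof.
elim: s p T => [|t s IHs] p T /=.
  move=> _ _ _ TP; exists p; first exact: extends_refl.
  by rewrite set_nil setD0.
move=> /andP[tNs uniq_s] sT le_r TP.
have [p1 pp1 [p1P tP]] := remove_row (sT t (mem_head _ _)) le_r TP.
have [||//|p2 p12 [p2P sP]] := IHs p1 (T :\ t) uniq_s.
- move=> x xs; rewrite !inE sT ?inE ?xs ?orbT // andbT.
  by apply: contraNneq tNs => <-.
- exact: leq_trans (mxrankS (mask_subl _ _ (subsetDl _ _))) le_r.
exists p2; first by rewrite mulnS; apply: extends_trans pp1 p12.
split; first by rewrite set_cons setDDl in p2P *.
move=> x; rewrite inE => /predU1P[->|/sP//]; exact: avail_extends p12 _.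
Qed.

Lemma add_columns p T J s : uniq s -> {in s, forall j, j \notin J} ->
  (forall j, avail p (u j)) ->
  (\rank (mask A T (J :|: [set j in s])) <= r)%N -> holds_basis p T J ->
  exists2 p', extends (4 * r * size s) p p' &
    holds_basis p' T (J :|: [set j in s]).
Proof.
elim: s p J => [|j s IHs] p J /=.
  move=> _ _ _ _ TP; exists p; first exact: extends_refl.
  by rewrite set_nil setU0.
move=> /andP[jNs uniq_s] sJ uP; rewrite set_cons setUCA setUA => le_r TP.
have [|p1 pp1 p1P] := add_column (sJ j (mem_head _ _)) uP _ TP.
- exact: leq_trans (rank_mask_subr _ _ (subsetUl _ _)) le_r.
have [|x||//|p2 p12 p2P] := IHs p1 (j |: J) uniq_s.
- move=> x xs; rewrite !inE negb_or sJ ?inE ?xs ?orbT // andbT.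
  by apply: contraNneq jNs => <-.
- exact: avail_extends pp1 _.
- by [].
by exists p2; rewrite // mulnS; apply: extends_trans pp1 p12.
Qed.

Variable b : 'I_N -> nat.
Hypothesis rank_le : forall k,
  (\rank (mask A [set i | k <= b i] [set j | b j < k])%N <= r)%N.

(** Passing from [k] to [k.+1], the rows of level [k] leave first, while the columns are exactly
    those of lower levels; this is when their products are output. Only then do the columns of level
    [k] enter. Each index thus costs [4 * r] as a row and [4 * r] as a column. *)
Lemma level_sweep p k : (forall j, avail p (u j)) ->
  exists2 p', extends (8 * r * #|[set i | b i < k]%N|) p p' &
    holds_basis p' [set i | k <= b i]%N [set j | b j < k]%N /\
    forall i, (b i < k)%N -> avail p' (partial_dot [set j | b j < b i]%N i).
Proof.
move=> uP; elim: k => [|k [p1 pp1 [p1P outP]]].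
  exists p; first exact: extends_refl.
  (* Before any column has entered, all products vanish and the empty set is a basis. *)
  split=> //; exists set0 => [|i]; last by rewrite inE.
  have J0 : [set j | b j < 0]%N = set0 by apply/setP => j; rewrite !inE ltn0.
  have rk0 T : \rank (mask A T set0) = 0%N.
    by apply/eqP; rewrite -leqn0 -(cards0 'I_N) rank_mask_cardr.
  rewrite J0; split; rewrite ?sub0set ?cards0 ?rk0 //.
  by rewrite (_ : mask A _ _ = 0) ?sub0mx //; apply/eqP; rewrite -mxrank_eq0 rk0.
pose s := enum [set i | b i == k].
have sE : [set i in s] = [set i | b i == k] by apply/setP => i; rewrite inE mem_enum.
have [|p2 p12 [p2P sP]] := remove_rows (s := s) (enum_uniq _) _ (rank_le k) p1P.
  by move=> i; rewrite mem_enum !inE => /eqP->.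
have TE : [set i | k <= b i]%N :\: [set i in s] = [set i | k < b i]%N.
  by apply/setP => i; rewrite sE !inE ltn_neqAle eq_sym.
have JE : [set j | b j < k]%N :|: [set i in s] = [set j | b j < k.+1]%N.
  by apply/setP => i; rewrite sE !inE ltnS [in RHS]leq_eqVlt orbC.
have [|j||p3 p23 p3P] := add_columns (s := s) (p := p2) (enum_uniq _) _ _ _ p2P.
- by move=> j; rewrite mem_enum !inE => /eqP->; rewrite ltnn.
- by apply: avail_extends p12 _; apply: avail_extends pp1 _.
- by rewrite TE JE.
exists p3.
  apply: extends_leq (extends_trans pp1 (extends_trans p12 p23)).
  rewrite -JE cardsU sE /s -!cardE (_ : _ :&: _ = set0) ?cards0 ?subn0; last first.
    by apply/setP => i; rewrite !inE; lia.
  by rewrite mulnDr leq_add2l; move: #|_| => x; lia.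
split; first by rewrite TE JE in p3P.
move=> i; rewrite ltnS leq_eqVlt => /predU1P[bi|lt_k].
  apply: avail_extends p23 _; rewrite bi; apply: sP.
  by rewrite mem_enum inE bi.
by apply: avail_extends p23 _; apply: avail_extends p12 _; apply: outP.
Qed.

Lemma avail_triangular_product p : (forall j, avail p (u j)) ->
  exists2 p', extends (8 * r * N) p p' &
    forall i, avail p' (partial_dot [set j | b j < b i]%N i).
Proof.
move=> uP.
(* Past the highest level every row has left, so every product has been output. *)
have [p' pp' [_ outP]] := level_sweep (\max_i b i).+1 uP.
exists p'; last by move=> i; apply: outP; rewrite ltnS leq_bigmax.
apply: extends_leq pp'; rewrite leq_mul2l.
by rewrite (leq_trans (max_card _)) ?card_ord // orbT.
Qed.

End TriangularProduct.

(** * Matrix-vector product from the three block parts *)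

Section HSSProduct.
Variables (F : fieldType) (N m : nat) (blk : 'I_N -> 'I_m) (A : 'M[F]_N).

(** For [0 < k < m] the mask is supported on the subdiagonal block with block rows from [k] to
    [m - 1] and block columns from 0 to [k - 1]; otherwise its rows or its columns are empty. *)
Lemma rank_mask_sub k :
  (\rank (mask A [set i | k <= blk i] [set j | blk j < k])%N <= sub_rank blk A)%N.
Proof.
case: k => [|k].
  rewrite (leq_trans (rank_mask_cardr _ _ _)) // eq_card0 // => j.
  by rewrite !inE ltn0.
have [lt_k|le_m] := ltnP k.+1 m; last first.
  rewrite (leq_trans (rank_mask_cardl _ _ _)) // eq_card0 // => i.
  rewrite !inE; apply/negbTE.
  by rewrite -ltnNge (leq_trans (ltn_ord _)).
have m_gt0 : (0 < m)%N by lia.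
have lt_m1 : (m.-1 < m)%N by lia.
pose o1 := Ordinal lt_k; pose o2 := Ordinal lt_m1; pose o3 := Ordinal m_gt0.
pose o4 := Ordinal (ltnW lt_k).
have -> : [set i | k.+1 <= blk i]%N = blk_range blk o1 o2.
  by apply/setP => i; rewrite !inE /=; have := ltn_ord (blk i); lia.
have -> : [set i | blk i < k.+1]%N = blk_range blk o3 o4.
  by apply/setP => i; rewrite !inE /=; lia.
apply: leq_trans (rank_mask _ _ _) _.
rewrite /sub_rank (bigop.bigmax_sup o1) // (bigop.bigmax_sup o2) //
  (bigop.bigmax_sup o3) //.
by rewrite (bigop.bigmax_sup o4) //=.
Qed.

(** The level [m - blk i] reverses the order of the blocks, so that the same sweep treats the
    superdiagonal part. These levels run from 1 to [m]: there are no columns for [k <= 1] and no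
    rows for [k > m]. *)
Lemma rank_mask_super k :
  (\rank (mask A [set i | k <= m - blk i] [set j | m - blk j < k])%N
    <= super_rank blk A)%N.
Proof.
have [le_k|lt_k] := leqP k 1.
  rewrite (leq_trans (rank_mask_cardr _ _ _)) // eq_card0 // => j.
  by rewrite !inE; have := ltn_ord (blk j); lia.
have [lt_m|le_m] := ltnP m k.
  rewrite (leq_trans (rank_mask_cardl _ _ _)) // eq_card0 // => i.
  by rewrite !inE; lia.
have m_gt0 : (0 < m)%N by lia.
have lt_m1 : (m.-1 < m)%N by lia.
have lt_mk : (m - k < m)%N by lia.
have lt_mk1 : ((m - k).+1 < m)%N by lia.
pose o1 := Ordinal m_gt0; pose o2 := Ordinal lt_mk.
pose o3 := Ordinal lt_mk1; pose o4 := Ordinal lt_m1.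
have -> : [set i | k <= m - blk i]%N = blk_range blk o1 o2.
  by apply/setP => i; rewrite !inE /=; have := ltn_ord (blk i); lia.
have -> : [set i | m - blk i < k]%N = blk_range blk o3 o4.
  by apply/setP => i; rewrite !inE /=; have := ltn_ord (blk i); lia.
apply: leq_trans (rank_mask _ _ _) _.
rewrite /super_rank (bigop.bigmax_sup o1) // (bigop.bigmax_sup o2) //
  (bigop.bigmax_sup o3) //.
by rewrite (bigop.bigmax_sup o4) //=.
Qed.

Variables (X : Type) (u : 'I_N -> (X -> F) -> F).

(** Diagonal blocks are multiplied densely, with two instructions per entry. *)
Lemma avail_diagonal_product (p : seq (instr F X)) : (forall j, avail p (u j)) ->
  exists2 p', extends (2 * diag_blocks_size blk) p p' &
    forall i, avail p' (partial_dot A u [set j | blk j == blk i] i).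
Proof.
move=> uP.
have [s sE] : exists s : seq 'I_N, s = enum 'I_N by eexists.
suff [p' pp' p'P] : exists2 p',
    extends (2 * \sum_(i <- s) #|[set j | blk j == blk i]|) p p' &
    forall i, i \in s -> avail p' (partial_dot A u [set j | blk j == blk i] i).
  exists p' => [|i]; last by apply: p'P; rewrite sE mem_enum.
  apply: extends_leq pp'; rewrite leq_mul2l /= sE big_enum /=.
  under eq_bigr do rewrite cardsE -sum1_card.
  rewrite pair_big_dep /= sum1_card /diag_blocks_size cardsE.
  apply: subset_leq_card; apply/fintype.subsetP => -[i j].
  by rewrite !unfold_in /= => /eqnP->; apply/eqnP.
elim: {sE} s => [|i s [p1 pp1 p1P]].
  by exists p => //; apply: extends_refl.
have [||p2 p12 p2P] := @avail_dot F X _ (enum [set j | blk j == blk i])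
  (fun j => fun=> A i j) u p1.
- by move=> j _; apply: avail_const.
- by move=> j _; apply: avail_extends pp1 _.
exists p2.
  rewrite big_cons mulnDr addnC [X in (_ + 2 * X)%N]cardE.
  exact: extends_trans pp1 p12.
move=> i'; rewrite inE => /predU1P[->|/p1P]; last exact: avail_extends p12.
by apply: eq_avail p2P => env; rewrite /partial_dot big_enum.
Qed.

(** Columns are split according to whether their block comes before, after or at that of the row;
    adding up the three partial vectors costs [2 * N]. *)
Lemma avail_block_product (p : seq (instr F X)) : (forall j, avail p (u j)) ->
  exists2 p', extends (8 * (sub_rank blk A + super_rank blk A) * N
                       + 2 * diag_blocks_size blk + 2 * N) p p' &
    forall i, avail p' (fun env => \sum_j A i j * u j env).
Proof.
move=> uP.
have [p1 pp1 p1P] := avail_triangular_product rank_mask_sub uP.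
have uP1 j := avail_extends pp1 (uP j).
have [p2 p12 p2P] := avail_triangular_product rank_mask_super uP1.
have uP2 j := avail_extends p12 (uP1 j).
have [p3 p23 p3P] := avail_diagonal_product uP2.
have [p4 p34 p4P] := avail_map_flop FAdd p3P (fun i => avail_extends p23 (p2P i)).
have [p5 p45 p5P] := avail_map_flop FAdd p4P
  (fun i => avail_extends p34 (avail_extends p23 (avail_extends p12 (p1P i)))).
exists p5.
  apply: extends_leq (extends_trans pp1 (extends_trans p12 (extends_trans p23
    (extends_trans p34 p45)))).
  rewrite card_ord; lia.
move=> i; apply: eq_avail (p5P i) => env.
rewrite /partial_dot [RHS](bigID (fun j => blk j < blk i)%N) /= [LHS]addrC.
congr (_ + _).
  by apply: eq_bigl => j; rewrite inE.
rewrite [RHS](bigID (fun j => blk j == blk i)) /=; congr (_ + _).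
  by apply: eq_bigl => j; rewrite inE -val_eqE /=; lia.
apply: eq_bigl => j; rewrite inE -val_eqE /=.
by have := ltn_ord (blk i); have := ltn_ord (blk j); lia.
Qed.

End HSSProduct.

(** * Cost of the complete expression *)

Section FastProduct.
Variables (F : fieldType) (N p q kappa alpha beta : nat) (Ct : 'M[F]_N).
Hypothesis hssCt : is_HSS kappa alpha beta Ct.
Local Notation X := (slot N p q).

Lemma avail_HSS_product (u : 'I_N -> (X -> F) -> F) (pr : seq (instr F X)) :
  (forall j, avail pr (u j)) ->
  exists2 pr', extends ((8 + 2 * kappa) * ((alpha + beta) * N) + 2 * N) pr pr' &
    forall i, avail pr' (fun env => \sum_j Ct i j * u j env).
Proof.
move: hssCt => [m [blk [_ -> -> le_diag]]] uP.
have [pr' prpr' pr'P] := avail_block_product blk Ct uP.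
exists pr' => //; apply: extends_leq prpr'.
by rewrite leq_add2r mulnDl -!mulnA leq_add2l leq_mul2l.
Qed.

(** One summand with [a] a column of V or L and [b] a row of R or W. The [5 * N] consists of [2 * N]
    from the product with [Ct], two Hadamard products and the update of [acc]. *)
Lemma avail_add_product_term f (acc : 'I_N -> (X -> F) -> F)
    (a b : 'I_N -> X) (pr : seq (instr F X)) :
  (forall h, avail pr (acc h)) ->
  exists2 pr', extends ((8 + 2 * kappa) * ((alpha + beta) * N) + 5 * N) pr pr' &
    forall h, avail pr' (fun env => flop_val f (acc h env)
      (env (a h) * \sum_k Ct h k * (env (b k) * env (SlotYt k)))).
Proof.
move=> accP.
have [pr1 pr01 pr1P] := avail_map_flop FMul
  (fun k => avail_input pr (b k)) (fun k => avail_input pr (SlotYt k : X)).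
have [pr2 pr12 pr2P] := avail_HSS_product pr1P.
have [pr3 pr23 pr3P] := avail_map_flop FMul (fun h => avail_input pr2 (a h)) pr2P.
have [pr4 pr34 pr4P] := avail_map_flop f
  (fun h => avail_extends pr23 (avail_extends pr12 (avail_extends pr01 (accP h))))
  pr3P.
exists pr4 => //.
apply: extends_leq (extends_trans pr01 (extends_trans pr12
  (extends_trans pr23 pr34))).
by rewrite card_ord; lia.
Qed.

(** The vector V R y is accumulated as a sum of columns of V times scalars, which avoids forming the
    [N] by [N] matrix V R: [2 * N] for the scalar, [N] for scaling and [N] for adding. *)
Lemma avail_add_outer_term (acc : 'I_N -> (X -> F) -> F) (j : 'I_q)
    (pr : seq (instr F X)) :
  (forall h, avail pr (acc h)) ->
  exists2 pr', extends (4 * N) pr pr' &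
    forall h, avail pr' (fun env => acc h env + env (SlotV h j) *
      \sum_k env (SlotR j k) * env (SlotY k)).
Proof.
move=> accP.
have [||pr1 pr01 pr1P] := @avail_dot F X _ (index_enum 'I_N)
  (fun k env => env (SlotR j k)) (fun k env => env (SlotY k)) pr.
- by move=> k _; apply: avail_input.
- by move=> k _; apply: avail_input.
have [pr2 pr12 pr2P] := avail_map_flop FMul
  (fun h => avail_input pr1 (SlotV h j : X)) (fun=> pr1P).
have [pr3 pr23 pr3P] := avail_map_flop FAdd
  (fun h => avail_extends pr12 (avail_extends pr01 (accP h))) pr2P.
exists pr3 => //.
apply: extends_leq (extends_trans pr01 (extends_trans pr12 pr23)).
rewrite (_ : size _ = N) ?card_ord; first by lia.
by rewrite -[RHS]card_ord cardE enumT.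
Qed.

(** A loop over the summands; the fold allows a step to add or to subtract its term. *)
Lemma avail_fold n (step : 'I_n -> 'I_N -> (X -> F) -> F -> F) c
    (acc : 'I_N -> (X -> F) -> F) (pr : seq (instr F X)) :
  (forall j acc pr, (forall h, avail pr (acc h)) ->
     exists2 pr', extends c pr pr' &
       forall h, avail pr' (fun env => step j h env (acc h env))) ->
  (forall h, avail pr (acc h)) ->
  exists2 pr', extends (n * c) pr pr' &
    forall h, avail pr' (fun env => foldr (fun j => step j h env) (acc h env)
                                     (index_enum 'I_n)).
Proof.
move=> stepP accP.
have size_enum : size (index_enum 'I_n) = n by rewrite -[RHS]card_ord cardE enumT.
rewrite -[X in (X * c)%N]size_enum.
elim: (index_enum _) => [|j s [pr1 pr01 pr1P]].
  by exists pr; rewrite ?mul0n //; apply: extends_refl.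
have [pr2 pr12 pr2P] := stepP j _ _ pr1P.
by exists pr2; rewrite //= mulSn addnC; apply: extends_trans pr01 pr12.
Qed.

Lemma computable_fast_product :
  computable_within (@fast_product_map F N p q Ct)
    ((9 + 2 * kappa) * ((p + q) * (alpha + beta + 1) * N)).
Proof.
pose c := ((8 + 2 * kappa) * ((alpha + beta) * N) + 5 * N)%N.
pose term (a b : 'I_N -> X) h env : F :=
  env (a h) * \sum_k Ct h k * (env (b k) * env (SlotYt k)).
have [|h|pr1 pr01 pr1P] := @avail_fold q
  (fun j h env z => z + term (fun h => SlotV h j) (SlotR j) h env)
  c (fun _ _ => 0) [::].
- by move=> j acc pr; exact:
    (avail_add_product_term FAdd (fun h => SlotV h j) (SlotR j)).
- exact: avail_const.
have [|pr2 pr12 pr2P] := avail_fold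
  (c := c) (step := fun (j : 'I_p) h env z =>
     z - term (fun h => SlotL h j) (SlotW j) h env)
  _ pr1P.
  by move=> j acc pr; exact:
    (avail_add_product_term FSub (fun h => SlotL h j) (SlotW j)).
have [pr3 pr23 pr3P] := avail_fold
  (step := fun (j : 'I_q) h env z =>
     z + env (SlotV h j) * \sum_k env (SlotR j k) * env (SlotY k))
  (fun j acc pr => @avail_add_outer_term acc j pr) pr2P.
apply: (computable_within_avail (p := pr3)).
  (* The [p + q] product terms cost [c] each and the [q] outer terms [4 * N] each; the 9 is the 5 in
     [c] plus this 4. *)
  apply: extends_leq (extends_trans pr01 (extends_trans pr12 pr23)).
  by nia.
have foldr_add (I : Type) (s : seq I) (G : I -> F) z :
    foldr (fun j z => z + G j) z s = z + \sum_(j <- s) G j.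
  elim: s => [|j s IHs] /=; first by rewrite big_nil addr0.
  by rewrite IHs big_cons [G j + _]addrC addrA.
move=> h; apply: eq_avail (pr3P h) => env.
rewrite foldr_add (foldr_add _ _ (fun j => - term _ _ h env)) foldr_add add0r.
rewrite /fast_product_map /fast_product -mulmxA !mxE !summxE sumrN; congr (_ - _ + _).
- apply: eq_bigr => j _; rewrite !mxE /term; congr (_ * _).
  by apply: eq_bigr => k _; rewrite !mxE.
- apply: eq_bigr => j _; rewrite !mxE /term; congr (_ * _).
  by apply: eq_bigr => k _; rewrite !mxE.
apply: eq_bigr => j _; rewrite !mxE; congr (_ * _).
by apply: eq_bigr => k _; rewrite !mxE.
Qed.

End FastProduct.

(** * Euclidean, spectral and infinity norms *)

Lemma sum_mul_sqr_le (R : realDomainType) (I : finType) (a b : I -> R) :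
  (\sum_i a i * b i) ^+ 2 <= (\sum_i a i ^+ 2) * (\sum_i b i ^+ 2).
Proof.
(* Lagrange's identity: this double sum is twice the gap in the Cauchy-Schwarz inequality. *)
have : 0 <= \sum_i \sum_j (a i * b j - a j * b i) ^+ 2.
  by apply: sumr_ge0 => i _; apply: sumr_ge0 => j _; apply: sqr_ge0.
have -> : \sum_i \sum_j (a i * b j - a j * b i) ^+ 2 =
    (\sum_i a i ^+ 2) * (\sum_i b i ^+ 2) *+ 2 - (\sum_i a i * b i) ^+ 2 *+ 2.
  rewrite [in RHS]mulr2n {2}[(\sum_i a i ^+ 2) * _]mulrC expr2.
  rewrite !big_distrlr /= -big_split -sumrMnl -sumrB /=; apply: eq_bigr => i _.
  rewrite -big_split -sumrMnl -sumrB /=; apply: eq_bigr => j _.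
  by ring.
by rewrite subr_ge0 lerMn2r.
Qed.

Section EuclideanNorm.
Variable R : realType.
Local Notation C := R[i].

Lemma cmodE (z : C) : (cmod z)%:C%C = `|z|.
Proof. by rewrite /cmod RRe_real ?normr_real. Qed.

Lemma cmod_ge0 (z : C) : 0 <= cmod z.
Proof. rewrite -lecR cmodE. exact: normr_ge0. Qed.

Lemma cmod0 : cmod (0 : C) = 0.
Proof. by rewrite /cmod normr0 /=. Qed.

Lemma cmodM (z w : C) : cmod (z * w) = cmod z * cmod w.
Proof. by apply: complexI; rewrite rmorphM /= !cmodE normrM. Qed.

Lemma cmodD (z w : C) : cmod (z + w) <= cmod z + cmod w.
Proof. by rewrite -lecR rmorphD /= !cmodE ler_normD. Qed.

Lemma cmodN (z : C) : cmod (- z) = cmod z.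
Proof. by rewrite /cmod normrN. Qed.

Lemma cmod_real (a : R) : cmod (a%:C%C) = `|a|.
Proof. by apply: complexI; rewrite cmodE normc_def /= expr0n addr0 sqrtr_sqr. Qed.

Section Fixed_size.
Variable n : nat.
Implicit Types x y : 'cV[C]_n.

Lemma eucl_norm_ge0 x : 0 <= eucl_norm x.
Proof. exact: sqrtr_ge0. Qed.

Lemma eucl_norm_sqr x : eucl_norm x ^+ 2 = \sum_i cmod (x i 0) ^+ 2.
Proof. by rewrite sqr_sqrtr // sumr_ge0 // => i _; apply: sqr_ge0. Qed.

Lemma eucl_norm0 : eucl_norm (0 : 'cV[C]_n) = 0.
Proof.
by apply/eqP; rewrite sqrtr_eq0 big1 // => i _; rewrite mxE cmod0 expr0n.
Qed.

Lemma eucl_normZ a x : eucl_norm (a *: x) = cmod a * eucl_norm x.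
Proof.
apply/eqP; rewrite -(eqrXn2 (n := 2)) ?mulr_ge0 ?eucl_norm_ge0 ?cmod_ge0 //.
rewrite exprMn !eucl_norm_sqr mulr_sumr; apply/eqP/eq_bigr => i _.
by rewrite mxE cmodM exprMn.
Qed.

Lemma eucl_normN x : eucl_norm (- x) = eucl_norm x.
Proof. by congr Num.sqrt; apply: eq_bigr => i _; rewrite mxE cmodN. Qed.

Lemma eucl_normD x y : eucl_norm (x + y) <= eucl_norm x + eucl_norm y.
Proof.
rewrite -(ler_pXn2r (n := 2)) ?nnegrE ?addr_ge0 ?eucl_norm_ge0 //.
have cs : \sum_i cmod (x i 0) * cmod (y i 0) <= eucl_norm x * eucl_norm y.
  rewrite -(ler_pXn2r (n := 2)) ?nnegrE ?mulr_ge0 ?eucl_norm_ge0 //.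
    by rewrite exprMn !eucl_norm_sqr sum_mul_sqr_le.
  by apply: sumr_ge0 => i _; rewrite mulr_ge0 ?cmod_ge0.
rewrite sqrrD !eucl_norm_sqr.
apply: (@le_trans _ _ (\sum_i (cmod (x i 0) + cmod (y i 0)) ^+ 2)).
  apply: ler_sum => i _; rewrite mxE ler_pXn2r ?nnegrE ?addr_ge0 ?cmod_ge0 //.
  exact: cmodD.
under eq_bigr do rewrite sqrrD.
by rewrite !big_split /= lerD2r lerD2l mulr2n lerD.
Qed.

Lemma eucl_norm_sum (I : finType) (f : I -> 'cV[C]_n) :
  eucl_norm (\sum_i f i) <= \sum_i eucl_norm (f i).
Proof.
elim/big_rec2: _ => [|i a z _ IH]; first by rewrite eucl_norm0.
by apply: le_trans (eucl_normD _ _) _; rewrite lerD2l.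
Qed.

Lemma cmod_le_eucl_norm x i : cmod (x i 0) <= eucl_norm x.
Proof.
rewrite -(ler_pXn2r (n := 2)) ?nnegrE ?eucl_norm_ge0 ?cmod_ge0 //.
rewrite eucl_norm_sqr (bigD1 i) //= lerDl.
by apply: sumr_ge0 => j _; apply: sqr_ge0.
Qed.

Lemma eucl_norm_eq0 x : eucl_norm x = 0 -> x = 0.
Proof.
move=> x0; apply/colP => i; rewrite mxE; apply/eqP.
have := cmod_le_eucl_norm x i; rewrite x0 => le0.
have /eqP : cmod (x i 0) == 0 by rewrite eq_le le0 cmod_ge0.
by move=> c0; rewrite -normr_eq0 -cmodE c0.
Qed.

Lemma eucl_norm_diag (d : 'rV[C]_n) x a : (forall i, cmod (d 0 i) <= a) ->
  0 <= a -> eucl_norm (diag_mx d *m x) <= a * eucl_norm x.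
Proof.
move=> le_a a_ge0.
rewrite -(ler_pXn2r (n := 2)) ?nnegrE ?mulr_ge0 ?eucl_norm_ge0 //.
rewrite exprMn !eucl_norm_sqr mulr_sumr; apply: ler_sum => i _.
rewrite mul_diag_mx mxE cmodM exprMn ler_wpM2r ?sqr_ge0 //.
by rewrite ler_pXn2r ?nnegrE ?cmod_ge0.
Qed.

End Fixed_size.

Section SpectralNorm.
Variables (m n : nat) (A : 'M[C]_(m, n)).

(** On the unit ball, [A *m x] combines the columns of [A] with coefficients of modulus at most 1,
    so the sum of the column norms is a bound. This makes the [sup] a genuine least upper bound. *)
Lemma spectral_norm_has_sup :
  has_sup [set eucl_norm (A *m x) | x in [set x | eucl_norm x <= 1]]%classic.
Proof.
split; first by exists (eucl_norm (A *m 0)), 0 => //=; rewrite eucl_norm0 ler01.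
exists (\sum_j eucl_norm (col j A)) => _ [x /= le1 <-].
have -> : A *m x = \sum_j x j 0 *: col j A.
  apply/colP => i; rewrite mxE summxE; apply: eq_bigr => j _.
  by rewrite !mxE mulrC.
apply: le_trans (eucl_norm_sum _) _; apply: ler_sum => j _.
rewrite eucl_normZ ler_piMl ?eucl_norm_ge0 //.
exact: le_trans (cmod_le_eucl_norm x j) le1.
Qed.

Lemma spectral_norm_ge0 : 0 <= spectral_norm A.
Proof.
apply: le_trans (eucl_norm_ge0 (A *m 0)) _.
apply: (sup_upper_bound spectral_norm_has_sup).
by exists 0 => //=; rewrite eucl_norm0 ler01.
Qed.

Lemma spectral_normP x : eucl_norm (A *m x) <= spectral_norm A * eucl_norm x.
Proof.
(* The zero vector cannot be rescaled to norm one and is treated apart. *)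
have [x0|x_gt0] := leP (eucl_norm x) 0.
  have /eucl_norm_eq0-> : eucl_norm x = 0.
    by apply/eqP; rewrite eq_le x0 eucl_norm_ge0.
  by rewrite mulmx0 !eucl_norm0 mulr0.
rewrite -ler_pdivrMr //.
have cmod_inv : cmod (eucl_norm x)^-1%:C%C = (eucl_norm x)^-1.
  by rewrite cmod_real ger0_norm // invr_ge0 ltW.
rewrite mulrC -cmod_inv -eucl_normZ scalemxAr.
apply: (sup_upper_bound spectral_norm_has_sup).
exists ((eucl_norm x)^-1%:C%C *: x) => //=.
by rewrite eucl_normZ cmod_inv mulVf ?gt_eqF.
Qed.

Lemma spectral_norm_le c : 0 <= c ->
  (forall x, eucl_norm (A *m x) <= c * eucl_norm x) -> spectral_norm A <= c.
Proof.
move=> c_ge0 le_c; apply: sup_le_ub; first by case: spectral_norm_has_sup.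
move=> _ [x /= le1 <-]; apply: le_trans (le_c x) _.
by rewrite ler_piMr.
Qed.

Lemma infinity_norm_ge0 : 0 <= infinity_norm A.
Proof.
rewrite /infinity_norm; elim/big_rec: _ => // i x _ x0.
by rewrite le_max x0 orbT.
Qed.

Lemma cmod_le_infinity_norm i j : cmod (A i j) <= infinity_norm A.
Proof.
apply: (@le_trans _ _ (\sum_j cmod (A i j))).
  by rewrite (bigD1 j) //= lerDl sumr_ge0 // => k _; apply: cmod_ge0.
exact: le_bigmax.
Qed.

End SpectralNorm.

(** An entry is bounded by its absolute row sum, so each diagonal factor stretches a vector by at
    most [c]; every one of the [n] terms contributes [c], the norm of [B], and [c] again. *)
Lemma eucl_norm_hadamard_sum m n (B : 'M[C]_m) (L : 'M[C]_(m, n))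
    (M : 'M[C]_(n, m)) c x :
  infinity_norm L <= c -> infinity_norm M <= c ->
  eucl_norm ((\sum_j diag_mx (col j L)^T *m B *m diag_mx (row j M)) *m x) <=
    n%:R * spectral_norm B * c ^+ 2 * eucl_norm x.
Proof.
move=> leL leM; have c_ge0 := le_trans (infinity_norm_ge0 L) leL.
rewrite mulmx_suml; apply: le_trans (eucl_norm_sum _) _.
apply: (@le_trans _ _ (\sum_(j < n) spectral_norm B * c ^+ 2 * eucl_norm x)).
  apply: ler_sum => j _; rewrite -!mulmxA.
  have diagP (d : 'rV_m) z : (forall i, cmod (d 0 i) <= c) ->
      eucl_norm (diag_mx d *m z) <= c * eucl_norm z.
    by move=> ?; apply: eucl_norm_diag.
  apply: le_trans (diagP _ _ _) _.
    by move=> i; rewrite !mxE (le_trans _ leL) ?cmod_le_infinity_norm.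
  rewrite expr2 -!mulrA mulrCA ler_wpM2l //.
  apply: le_trans (spectral_normP _ _) _.
  rewrite ler_wpM2l ?spectral_norm_ge0 //; apply: diagP => i.
  by rewrite !mxE (le_trans _ leM) ?cmod_le_infinity_norm.
by rewrite sumr_const card_ord -[leLHS]mulr_natl !mulrA.
Qed.

End EuclideanNorm.

(** * The exact Cauchy formula and the error of its approximation *)

Lemma hadamard_mulmx (F : comPzRingType) N (A : 'M[F]_N) (a b : 'cV[F]_N) y :
  hadamard a (A *m hadamard b y) = diag_mx a^T *m A *m diag_mx b^T *m y.
Proof.
have diagE (c z : 'cV[F]_N) : diag_mx c^T *m z = hadamard c z.
  by apply/matrixP => i j; rewrite mul_diag_mx !mxE (ord1 j).
by rewrite -!mulmxA !diagE.
Qed.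

Section Approximation.
Variables (R : realType) (N p q : nat) (D : loewner_data R N p q).
Local Notation C := R[i].

(** Entry by entry, the numerator of S - x L is (mu - x) v r - (lambda - x) l w. Writing mu - x as
    (mu - lambda) + (lambda - x) splits off v r and leaves (lambda - x) times the Loewner entry. *)
Lemma shifted_loewner_mulmx (y : 'cV[C]_N) (x : C) :
  (shifted_loewner_mx D - x *: loewner_mx D) *m y
    = fast_product (cauchy_mx D) (V_mx D) (R_mx D) (L_mx D) (W_mx D)
        ((Lambda_mx D - x%:M) *m y) y.
Proof.
rewrite /fast_product.
under eq_bigr do rewrite hadamard_mulmx trmxK.
under [X in _ - X + _]eq_bigr do rewrite hadamard_mulmx trmxK.
rewrite -!mulmx_suml -mulmxBl mulmxA -mulmxDl; congr (_ *m y).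
apply/matrixP => h k; rewrite [RHS]mxE [X in _ = X + _]mxE.
under [X in _ = X + _]eq_bigr do rewrite [(Lambda_mx D - _) _ _]mxE.
rewrite (bigD1 k) //= [X in _ + X + _]big1 ?addr0; last first.
  by move=> j /negPf jk; rewrite !mxE jk !mulr0n subr0 mulr0.
(* Disjointness of the left and right points makes the Cauchy denominators nonzero, as [field]
   requires. *)
have nz := points_disjoint D h k.
have {}nz : mu D h - lambda D k != 0 by rewrite subr_eq0.
rewrite !mxE eqxx !mulr1n !summxE.
have -> : \sum_(j < q) (diag_mx (col j (V_mx D))^T *m cauchy_mx D *m
    diag_mx (row j (R_mx D))) h k =
    (left_data D h *m right_dir D k) 0 0 / (mu D h - lambda D k).
  rewrite mxE mulr_suml; apply: eq_bigr => j _.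
  by rewrite mul_mx_diag mxE mul_diag_mx !mxE mulrAC.
have -> : \sum_(j < p) (diag_mx (col j (L_mx D))^T *m cauchy_mx D *m
    diag_mx (row j (W_mx D))) h k =
    (left_dir D h *m right_data D k) 0 0 / (mu D h - lambda D k).
  rewrite mxE mulr_suml; apply: eq_bigr => j _.
  by rewrite mul_mx_diag mxE mul_diag_mx !mxE mulrAC.
have -> : \sum_j V_mx D h j * R_mx D j k = (left_data D h *m right_dir D k) 0 0.
  by rewrite mxE; apply: eq_bigr => j _; rewrite !mxE.
by rewrite ![(_ *m _) 0 0]mxE; field.
Qed.

(** Apart from the common term V R y, the expression is linear in the Cauchy factor, so the
    difference [B] enters separately and one matrix [E] serves all vectors. *)
Lemma approximation_error (Ct : 'M[C]_N) :
  exists2 E : 'M[C]_N,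
    spectral_norm E <=
       (p + q)%:R * spectral_norm (cauchy_mx D - Ct) *
       (Num.max (infinity_norm (V_mx D)) (Num.max (infinity_norm (R_mx D))
         (Num.max (infinity_norm (L_mx D)) (infinity_norm (W_mx D))))) ^+ 2 &
    forall yt y,
      fast_product (cauchy_mx D) (V_mx D) (R_mx D) (L_mx D) (W_mx D) yt y =
      fast_product Ct (V_mx D) (R_mx D) (L_mx D) (W_mx D) yt y + E *m yt.
Proof.
set c := Num.max _ _; set B := cauchy_mx D - Ct.
pose E1 := \sum_j diag_mx (col j (V_mx D))^T *m B *m diag_mx (row j (R_mx D)).
pose E2 := \sum_j diag_mx (col j (L_mx D))^T *m B *m diag_mx (row j (W_mx D)).
exists (E1 - E2).
  apply: spectral_norm_le => [|x].
    by rewrite mulr_ge0 ?sqr_ge0 // mulr_ge0 ?ler0n ?spectral_norm_ge0.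
  rewrite mulmxBl; apply: le_trans (eucl_normD _ _) _; rewrite eucl_normN.
  (* [E1] has [q] terms and [E2] has [p], which gives the factor [p + q]. *)
  rewrite addnC natrD !mulrDl; apply: lerD; apply: eucl_norm_hadamard_sum.
  1-4: by rewrite !le_max lexx ?orbT.
move=> yt y; rewrite /fast_product [RHS]addrAC; congr (_ + _).
rewrite mulmxBl !mulmx_suml addrACA -opprD -!big_split /=; congr (_ - _).
  all: apply: eq_bigr => j _; rewrite !hadamard_mulmx trmxK.
  all: by rewrite -mulmxDl -mulmxDl -mulmxDr [Ct + B]addrC subrK.
Qed.

End Approximation.

Theorem proposition1 (R : realType) (kappa : nat) :
  exists K : nat,
  forall (N p q : nat) (D : loewner_data R N p q)
    (alpha beta : nat) (Ct : 'M[R[i]]_N),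
  is_HSS kappa alpha beta Ct ->
  (M_mx D *m loewner_mx D - loewner_mx D *m Lambda_mx D
     = V_mx D *m R_mx D - L_mx D *m W_mx D ->
   M_mx D *m shifted_loewner_mx D - shifted_loewner_mx D *m Lambda_mx D
     = M_mx D *m V_mx D *m R_mx D - L_mx D *m W_mx D *m Lambda_mx D ->
   exists E : 'M[R[i]]_N,
     spectral_norm E <=
       (p + q)%:R * spectral_norm (cauchy_mx D - Ct) *
       (Num.max (infinity_norm (V_mx D)) (Num.max (infinity_norm (R_mx D))
         (Num.max (infinity_norm (L_mx D)) (infinity_norm (W_mx D))))) ^+ 2
     /\
     forall (y : 'cV[R[i]]_N) (x : R), (exists i : 'I_N, x = freq D i) ->
       let yt := (Lambda_mx D - (x%:C%C)%:M) *m y in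
       (shifted_loewner_mx D - x%:C%C *: loewner_mx D) *m y
         = fast_product Ct (V_mx D) (R_mx D) (L_mx D) (W_mx D) yt y
           + E *m yt)
  /\
  computable_within (@fast_product_map R[i] N p q Ct)
    (K * ((p + q) * (alpha + beta + 1) * N)).
Proof.
exists (9 + 2 * kappa)%N => N p q D alpha beta Ct hssCt; split; last first.
  exact: computable_fast_product hssCt.
move=> _ _; have [E leE EP] := approximation_error D Ct.
exists E; split=> // y x _ /=.
by rewrite shifted_loewner_mulmx EP.
Qed.
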